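(* For any $\epsilon>0$ and any core-set size $k'\ge k$, there are instances of monotone submodular maximization with cardinality constraint $k$ for which $\mathsf{Greedy}$ (returning $k'$ items per machine) is at most a $(2-\sqrt2+O(\epsilon))$-approximate randomized composable core-set, even if each item is sent to $C\le\sqrt{\epsilon m}$ machines; i.e., $\mathbb E[f_k(\bigcup_{i=1}^m\mathsf{Greedy}(T_i))]\le(2-\sqrt2+O(\epsilon))\max_{|S|\le k}f(S)$ on these instances.
   Context: $m$ is the number of machines; each item is sent to $C$ distinct machines chosen uniformly at random and $T_i$ is the set of items machine $i$ receives. For a finite ground set $\mathbb N$ and $f:2^{\mathbb N}\to\mathbb R_{\ge0}$, $f_k(S)=\max_{S'\subseteq S,|S'|\le k}f(S')$. $\mathsf{Greedy}$ on $T$ starts from $\emptyset$ and, for $k'$ steps, adds an item of $T$ of maximum marginal value $f(S\cup\{x\})-f(S)$.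
   Formalization: The claim is proved for all cardinality constraints k that are sufficiently large depending on ε (and every k' ≥ k); for small k, e.g. k = 1, Greedy always retains the best item and the stated bound fails for small ε. *)

(* Defs.v *)
From mathcomp Require Import all_boot all_order all_algebra.
From mathcomp Require Import reals.

Set Implicit Arguments.
Unset Strict Implicit.
Unset Printing Implicit Defensive.

Import Order.TTheory GRing.Theory Num.Theory.
Local Open Scope ring_scope.

Section Instance.
Context {R : realType} {N : finType}.
Implicit Types (f : {set N} -> R) (S T A B : {set N}).

Definition nonnegative f := forall S, 0 <= f S.

Definition monotone f := forall A B, A \subset B -> f A <= f B.

Definition submodular f :=
  forall A B, f (A :|: B) + f (A :&: B) <= f A + f B.

(* The default value 0 of the maximum plays no role when f is nonnegative:
   S' = set0 is always in range. *)
Definition fmax f (k : nat) S : R :=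
  \big[Num.max/0]_(S' : {set N} | (S' \subset S) && (#|S'| <= k)%N) f S'.

Definition opt f (k : nat) : R := fmax f k [set: N].

Definition marginal f S (x : N) : R := f (x |: S) - f S.

(* [greedy_run f T n S] : S can be the current solution after n steps of the
   greedy algorithm on T. Each step adds a new item of T, ties being broken
   arbitrarily; once T is exhausted the solution no longer changes, so the
   output has minn n #|T| items. *)
Inductive greedy_run f T : nat -> {set N} -> Prop :=
| greedy_start : greedy_run f T 0 set0
| greedy_add n S x of
    greedy_run f T n S & x \in T :\: S
  & (forall y, y \in T :\: S -> marginal f S y <= marginal f S x) :
    greedy_run f T n.+1 (x |: S)
| greedy_exhausted n S of greedy_run f T n S & T \subset S :
    greedy_run f T n.+1 S.

(* [Greedy] implements the greedy algorithm with n steps, for some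
   deterministic way of breaking ties. *)
Definition is_greedy f (n : nat) (Greedy : {set N} -> {set N}) :=
  forall T, greedy_run f T n (Greedy T).

Lemma greedy_run_exists f n T : exists S, greedy_run f T n S.
Proof.
elim: n => [|n [S runS]]; first by exists set0; constructor.
have [TS0|[x0 x0P]] := set_0Vmem (T :\: S).
  by exists S; apply: greedy_exhausted => //; rewrite -setD_eq0 TS0.
case: (arg_maxP (marginal f S) x0P) => x xP xmax.
by exists (x |: S); apply: greedy_add.
Qed.

(* [s x] is the set of machines item x is sent to. Under the uniform
   distribution on [assignments m C], the sets [s x] are independent, uniformly
   distributed C-subsets of the m machines. *)
Definition assignments (m C : nat) : {set {ffun N -> {set 'I_m}}} :=
  [set s : {ffun N -> {set 'I_m}} | [forall x, #|s x| == C]].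

Definition received m (s : {ffun N -> {set 'I_m}}) (i : 'I_m) : {set N} :=
  [set x | i \in s x].

Definition expectation (m C : nat) (X : {ffun N -> {set 'I_m}} -> R) : R :=
  (\sum_(s in assignments m C) X s) / #|assignments m C|%:R.

End Instance.

(* Main.v *)
(* The ground set has one big item, h = k - 1 hidden items, and unboundedly many
   covers and fillers. The first n covers overlap both the big item and the
   hidden ones. A machine that does not hold the big item always sees a cover
   (as long as fewer than n are taken) or a filler (afterwards) worth more than
   any hidden item, so Greedy never returns a hidden item there. Once the big
   item is known, however, covers and fillers are worth only 2h each, whence a
   solution without hidden items has value at most n (n + 1) + 2 h k, against
   n (n + 1) + 2 n h + 2 (h - 1) h for the big item with the hidden ones. For
   n ~ sqrt 2 * h the ratio tends to 4 / (4 + 2 sqrt 2) = 2 - sqrt 2.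
   A given hidden item shares a machine with the big one with probability at
   most C^2 / m <= eps, and the covers and fillers come in large blocks so that
   all machines hold an item of each block with high probability; hence at most
   O(eps) h hidden items are selected in expectation. *)
Require Import Defs.
From mathcomp Require Import all_boot all_order all_algebra.
From mathcomp Require Import reals zify ring lra.

Set Implicit Arguments.
Unset Strict Implicit.
Unset Printing Implicit Defensive.

Import Order.TTheory GRing.Theory Num.Theory.
Local Open Scope ring_scope.

(** * Closure properties of antitone supermodular functions *)

Section AntitoneSupermodular.
Context {R : realType} {N : finType}.
Implicit Types (F G : {set N} -> R) (A B D S : {set N}).

(** Subtracting such a function from a monotone modular one gives a monotone submodular function.
    Nonnegativity makes the class stable under products. *)
Definition antitone_supermodular F :=
  [/\ forall S, 0 <= F S,
      forall A B, A \subset B -> F B <= F A &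
      forall A B, F A + F B <= F (A :|: B) + F (A :&: B)].

(** The lower bounds on [F (A :&: B)] and [G (A :&: B)] are nonnegative, so they can be multiplied.
    If [F] drops by [a], [b] from [A], [B] to their union, and [G] by [a'], [b'], the surplus is
    [a b' + b a' >= 0]. *)
Lemma antitone_supermodularM F G :
  antitone_supermodular F -> antitone_supermodular G ->
  antitone_supermodular (fun S => F S * G S).
Proof.
move=> [F0 Fanti Fsup] [G0 Ganti Gsup]; split=> [S|A B AB|A B].
- by rewrite mulr_ge0.
- by rewrite ler_pM // ?Fanti ?Ganti.
have lbF : F A + F B - F (A :|: B) <= F (A :&: B) by rewrite lerBlDl.
have lbG : G A + G B - G (A :|: B) <= G (A :&: B) by rewrite lerBlDl.
have FA : F (A :|: B) <= F A by rewrite Fanti ?subsetUl.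
have FB : F (A :|: B) <= F B by rewrite Fanti ?subsetUr.
have GA : G (A :|: B) <= G A by rewrite Ganti ?subsetUl.
have GB : G (A :|: B) <= G B by rewrite Ganti ?subsetUr.
have GU := G0 (A :|: B); have FU := F0 (A :|: B).
have lb0F : 0 <= F A + F B - F (A :|: B) by lra.
have lb0G : 0 <= G A + G B - G (A :|: B) by lra.
have := ler_pM lb0F lb0G lbF lbG.
by nra.
Qed.

Lemma antitone_supermodularD F G :
  antitone_supermodular F -> antitone_supermodular G ->
  antitone_supermodular (fun S => F S + G S).
Proof.
move=> [F0 Fanti Fsup] [G0 Ganti Gsup]; split=> [S|A B AB|A B].
- by rewrite addr_ge0.
- by rewrite lerD // ?Fanti ?Ganti.
- by rewrite addrACA [leRHS]addrACA lerD.
Qed.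

Lemma antitone_supermodular_cst (c : R) :
  0 <= c -> antitone_supermodular (fun=> c).
Proof. by []. Qed.

Lemma cards_setIUI D A B :
  (#|(A :|: B) :&: D| + #|A :&: B :&: D| = #|A :&: D| + #|B :&: D|)%N.
Proof. by rewrite setIUl setIIl cardsUI. Qed.

Definition deficit D (n : nat) S : R := (n - #|S :&: D|)%N%:R.

(** The deficit is a convex nonincreasing function of a modular count; truncation at 0 preserves
    convexity. *)
Lemma deficit_antitone_supermodular D n : antitone_supermodular (deficit D n).
Proof.
split=> [S|A B AB|A B]; first exact: ler0n.
  by rewrite ler_nat leq_sub2l // subset_leq_card // setSI.
rewrite /deficit -!natrD ler_nat.
have := cards_setIUI D A B.
have : (#|A :&: D| <= #|(A :|: B) :&: D|)%N.
  by rewrite subset_leq_card // setSI // subsetUl.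
have : (#|B :&: D| <= #|(A :|: B) :&: D|)%N.
  by rewrite subset_leq_card // setSI // subsetUr.
by lia.
Qed.

End AntitoneSupermodular.

(** * Expectations over independent uniform draws of machines *)

Section Expectation.
Context {R : realType} {N : finType} (m C : nat).
Implicit Types (X Y : {ffun N -> {set 'I_m}} -> R).

Lemma le_expectation X Y :
  (forall s, s \in assignments m C -> X s <= Y s) ->
  expectation C X <= expectation C Y.
Proof. by move=> XY; rewrite ler_wpM2r ?invr_ge0 ?ler0n ?ler_sum. Qed.

Lemma expectationD X Y :
  expectation C (fun s => X s + Y s) = expectation C X + expectation C Y.
Proof. by rewrite /expectation big_split mulrDl. Qed.

Lemma expectationZ (a : R) X :
  expectation C (fun s => a * X s) = a * expectation C X.
Proof. by rewrite /expectation -mulr_sumr mulrA. Qed.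

Lemma expectation_sum (I : finType) (P : pred I)
    (F : I -> {ffun N -> {set 'I_m}} -> R) :
  expectation C (fun s => \sum_(i | P i) F i s)
  = \sum_(i | P i) expectation C (F i).
Proof. by rewrite /expectation exchange_big mulr_suml. Qed.

Lemma sum_assignments_prod (F : N -> {set 'I_m} -> R) :
  \sum_(s in assignments m C) \prod_x F x (s x)
  = \prod_x \sum_(A : {set 'I_m} | #|A| == C) F x A.
Proof.
rewrite bigA_distr_big; apply: eq_bigl => s.
rewrite inE; apply/forallP/ffun_onP => sC x; exact: sC.
Qed.

Lemma card_assignments : #|assignments (N := N) m C| = ('C(m, C) ^ #|N|)%N.
Proof.
rewrite -[m in 'C(m, C)]card_ord -card_draws -card_ffun_on; apply: eq_card => s.
by rewrite inE; apply/forallP/ffun_onP => sC x; have := sC x; rewrite inE.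
Qed.

Lemma expectation_cst (c : R) :
  (C <= m)%N -> expectation (N := N) (m := m) C (fun=> c) = c.
Proof.
move=> leCm; rewrite /expectation sumr_const -[c *+ _]mulr_natr.
rewrite mulfK // pnatr_eq0.
by rewrite card_assignments expn_eq0 negb_and -lt0n bin_gt0 leCm.
Qed.

Lemma sum_draws1 : \sum_(A : {set 'I_m} | #|A| == C) 1 = 'C(m, C)%:R :> R.
Proof.
rewrite -[m in 'C(m, C)]card_ord -card_draws -sum1_card natr_sum.
by apply: eq_bigl => A; rewrite inE.
Qed.

Definition draw_mean (g : {set 'I_m} -> R) : R :=
  (\sum_(A : {set 'I_m} | #|A| == C) g A) / 'C(m, C)%:R.

(** This is independence: the assignments form a product set, so the sum of products factors over
    items, and each item outside [X] contributes 1. *)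
Lemma expectation_prod (X : {set N}) (g : {set 'I_m} -> R) :
  (C <= m)%N ->
  expectation C (fun s : {ffun N -> {set 'I_m}} => \prod_(x in X) g (s x))
  = draw_mean g ^+ #|X|.
Proof.
move=> leCm; have binN0 : 'C(m, C)%:R != 0 :> R.
  by rewrite pnatr_eq0 -lt0n bin_gt0.
rewrite /expectation card_assignments natrX -[_ ^+ #|N|]prodr_const.
rewrite (eq_bigr (fun s : {ffun N -> {set 'I_m}} =>
  \prod_x (if x \in X then g (s x) else 1))); last first.
  by move=> s _; rewrite big_mkcond.
rewrite (sum_assignments_prod (fun x A => if x \in X then g A else 1)).
rewrite -prodf_div -prodr_const [RHS]big_mkcond /=.
by apply: eq_bigr => x _; case: ifP => // _; rewrite sum_draws1 divff.
Qed.

Lemma draw_mean_notin (i : 'I_m) :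
  (C <= m)%N -> draw_mean (fun A => (i \notin A)%:R) = 1 - C%:R / m%:R.
Proof.
move=> leCm; rewrite /draw_mean.
have m0 : (0 < m)%N by apply: leq_ltn_trans (ltn_ord i).
have binN0 : 'C(m, C)%:R != 0 :> R by rewrite pnatr_eq0 -lt0n bin_gt0.
have -> : \sum_(A : {set 'I_m} | #|A| == C) (i \notin A)%:R
  = 'C(m.-1, C)%:R :> R.
  rewrite -[m in m.-1]card_ord -(cardsC1 i) -cards_draws -sum1_card natr_sum.
  rewrite [RHS](eq_bigl (fun A : {set 'I_m} => (#|A| == C) && (i \notin A)))
    => [|A].
    by rewrite big_mkcondr; apply: eq_bigr => A _; case: (i \in A).
  by rewrite inE subsetC sub1set inE andbC.
have mN0 : m%:R != 0 :> R by rewrite pnatr_eq0 -lt0n.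
have /(congr1 (fun p => p%:R : R)) : (m * 'C(m.-1, C) = (m - C) * 'C(m, C))%N.
  by case: (m) m0 => // p _; rewrite mul_bin_down.
rewrite !natrM natrB // => binE.
apply: (mulfI mN0); rewrite mulrA binE mulfK // mulrBr mulr1.
by rewrite mulrCA divff ?mulr1.
Qed.

Lemma draw_mean_in (i : 'I_m) :
  (C <= m)%N -> draw_mean (fun A => (i \in A)%:R) = C%:R / m%:R.
Proof.
move=> leCm; have := draw_mean_notin i leCm; rewrite /draw_mean.
have binN0 : 'C(m, C)%:R != 0 :> R by rewrite pnatr_eq0 -lt0n bin_gt0.
have -> : \sum_(A : {set 'I_m} | #|A| == C) (i \notin A)%:R
  = 'C(m, C)%:R - \sum_(A : {set 'I_m} | #|A| == C) (i \in A)%:R :> R.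
  by rewrite -sum_draws1 -sumrB; apply: eq_bigr => A _;
    case: (i \in A); rewrite ?subr0 ?subrr.
rewrite mulrBl divff // => eqB; lra.
Qed.

End Expectation.

(** * Generic facts on intersections and greedy runs *)

Section GreedyRun.
Context {R : realType} {N : finType}.

Lemma cards_setU1I (D S : {set N}) (x : N) :
  x \notin S -> #|(x |: S) :&: D| = ((x \in D) + #|S :&: D|)%N.
Proof.
move=> xS; rewrite setIUl; case: (boolP (x \in D)) => xD.
  rewrite (setIidPl _) ?sub1set // cardsU1 !inE (negbTE xS) //.
by rewrite (disjoint_setI0 _) ?set0U // disjoints1.
Qed.

Lemma exists_fresh (D S T : {set N}) :
  (#|S :&: D| < #|T :&: D|)%N -> exists2 x, x \in D & x \in T :\: S.
Proof.
move=> lt; have /subsetPn[x] : ~~ (T :&: D \subset S :&: D).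
  by apply: contraL lt => /subset_leq_card; rewrite -leqNgt.
rewrite !inE => /andP[xT xD]; rewrite xD andbT => xS.
by exists x; rewrite // !inE xS.
Qed.

Lemma greedy_run_sub (f : {set N} -> R) (T : {set N}) t (S : {set N}) :
  greedy_run f T t S -> S \subset T /\ (#|S| <= t)%N.
Proof.
elim=> [|p {}S x _ [ST Sp] xTS _|p {}S _ [ST Sp] _].
- by rewrite sub0set cards0.
- move: xTS; rewrite inE => /andP[xS xT].
  by rewrite subUset sub1set xT ST cardsU1 xS.
- by split=> //; rewrite leqW.
Qed.

End GreedyRun.

(** * The hard function, its optimum, and greedy without the big item *)

Section HardInstance.
Context {R : realType} (h n k' L : nat).

(** [None] is the big item and [Some j] a hidden one. The right summand holds [n] blocks of covers
    and [k'] blocks of fillers, each made of [L] interchangeable copies. *)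
Definition item : finType := (option 'I_h + ('I_n + 'I_k') * 'I_L)%type.

Implicit Types (S T : {set item}) (x y : item).

Definition big_item : item := inl None.

Definition hidden : {set item} :=
  [set x : item | if x is inl (Some _) then true else false].

Definition covers : {set item} :=
  [set x : item | if x is inr (inl _, _) then true else false].

Definition fillers : {set item} :=
  [set x : item | if x is inr (inr _, _) then true else false].

(* Scaled to integers: given j covers (j <= n), each hidden item is worth
   2 (h - 1 + n - j), the big item (n - j) (n - j + 1), a filler 2 h; a cover is
   worth its overlap with the big item and all h hidden ones. The formula
   collects this as a modular part minus the losses in terms of the deficits
   n - j, h - #hidden and 1 - #big, each nonnegative, antitone and
   supermodular. *)
Definition hard S : R :=
  2 * n%:R * h%:R + n%:R * (n%:R + 1)
  + (2 * h%:R * #|S :&: fillers|%:R + 2 * (h%:R - 1) * #|S :&: hidden|%:R)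
  - (2 * (deficit covers n S * deficit hidden h S)
     + deficit covers n S * (deficit covers n S + 1)
       * deficit [set big_item] 1 S).

Lemma card_hidden : #|hidden| = h.
Proof.
have -> : hidden = [set inl (Some j) | j : 'I_h].
  apply/setP => -[[j|]|[b l]]; rewrite inE.
  - by rewrite imset_f.
  - by apply/esym/imsetP => -[].
  - by apply/esym/imsetP => -[].
by rewrite card_imset ?card_ord // => j1 j2 [].
Qed.

Lemma hard_losses_antitone_supermodular :
  antitone_supermodular (fun S =>
    2 * (deficit covers n S * deficit hidden h S)
    + deficit covers n S * (deficit covers n S + 1) * deficit [set big_item] 1 S
    : R).
Proof.
have defS D p := @deficit_antitone_supermodular R _ D p.
apply: antitone_supermodularD.
  apply: antitone_supermodularM; first exact: antitone_supermodular_cst.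
  exact: antitone_supermodularM.
apply: antitone_supermodularM => //; apply: antitone_supermodularM => //.
by apply: antitone_supermodularD => //; exact: antitone_supermodular_cst.
Qed.

Lemma hard_monotone : (0 < h)%N -> monotone hard.
Proof.
move=> h0 A B AB; have [_ anti _] := hard_losses_antitone_supermodular.
apply: lerB; last exact: anti.
have leI D : (#|A :&: D| <= #|B :&: D|)%N by rewrite subset_leq_card ?setSI.
have h1 : 0 <= h%:R - 1 :> R by rewrite subr_ge0 ler1n.
by rewrite lerD2l lerD // ler_wpM2l ?ler_nat ?leI // mulr_ge0 ?ler0n.
Qed.

Lemma hard_submodular : submodular hard.
Proof.
move=> A B; have [_ _ /(_ A B)] := hard_losses_antitone_supermodular.
have /(congr1 (fun p => p%:R : R)) := cards_setIUI fillers A B.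
have /(congr1 (fun p => p%:R : R)) := cards_setIUI hidden A B.
rewrite !natrD /hard.
set hU := #|_|%:R; set hI := #|_|%:R; set hA := #|_|%:R; set hB := #|_|%:R.
move=> /(congr1 (fun p => 2 * (h%:R - 1) * p)) /=; rewrite !mulrDr => eqh.
set fU := #|_|%:R; set fI := #|_|%:R; set fA := #|_|%:R; set fB := #|_|%:R.
move=> /(congr1 (fun p => 2 * h%:R * p)) /=; rewrite !mulrDr => eqf.
lra.
Qed.

Lemma hard_set0 : hard set0 = 0.
Proof. by rewrite /hard /deficit !set0I !cards0 !subn0; ring. Qed.

Lemma hard_nonnegative : (0 < h)%N -> nonnegative hard.
Proof. by move=> h0 S; rewrite -hard_set0 hard_monotone ?sub0set. Qed.

(** The big item's loss is dropped. With [p] covers and [z] hidden items, the deficits satisfy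
    [d >= n - p] and [e >= h - z], so [d e >= h (n - p) - n z]; covers and fillers then count [2 h]
    each. *)
Lemma hard_upper k S : (#|S| <= k)%N ->
  hard S <= n%:R * (n%:R + 1) + 2 * h%:R * k%:R
            + 2 * (h%:R + n%:R) * #|S :&: hidden|%:R.
Proof.
move=> Sk; have Sk' : (#|S :&: covers| + #|S :&: fillers| <= k)%N.
  apply: leq_trans Sk; rewrite -cardsUI setIACA setIid.
  rewrite (_ : covers :&: fillers = set0) ?setI0 ?cards0 ?addn0.
    by rewrite subset_leq_card // subUset !subsetIl.
  by apply/setP => -[?|[[?|?] ?]]; rewrite !inE.
move: Sk'; rewrite -(ler_nat R) natrD /hard.
have d_ge : n%:R - #|S :&: covers|%:R <= deficit covers n S :> R.
  by rewrite /deficit lerBlDr -natrD ler_nat; lia.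
have d_le : deficit covers n S <= n%:R :> R by rewrite ler_nat leq_subr.
have d_ge0 : 0 <= deficit covers n S :> R by rewrite ler0n.
have e_ge : h%:R - #|S :&: hidden|%:R <= deficit hidden h S :> R.
  by rewrite /deficit lerBlDr -natrD ler_nat; lia.
have w_ge0 : 0 <= deficit [set big_item] 1 S :> R by rewrite ler0n.
move: d_ge d_le d_ge0 e_ge w_ge0.
have : 0 <= h%:R :> R by rewrite ler0n.
have : 0 <= #|S :&: hidden|%:R :> R by rewrite ler0n.
move: (deficit covers n S) (deficit hidden h S)
  (deficit [set big_item] 1 S) => d e w.
move: (#|S :&: hidden|%:R) (#|S :&: covers|%:R) (#|S :&: fillers|%:R) => z p y.
move: (h%:R) (n%:R) (k%:R) => H M K.
move=> z0 H0 d_ge d_le d_ge0 e_ge w_ge0 py.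
have dw : 0 <= d * (d + 1) * w by rewrite !mulr_ge0 ?addr_ge0.
have de : 0 <= d * (e - (H - z)) by apply: mulr_ge0; lra.
have hd : 0 <= H * (d - (M - p)) by apply: mulr_ge0; lra.
have hk : 0 <= H * (K - (p + y)) by apply: mulr_ge0; lra.
have zd : 0 <= z * (M - d) by apply: mulr_ge0; lra.
nra.
Qed.

(** The big item with all hidden ones has [h + 1] elements and makes both loss terms vanish. *)
Lemma hard_opt_lower :
  2 * n%:R * h%:R + n%:R * (n%:R + 1) + 2 * (h%:R - 1) * h%:R
  <= opt hard h.+1.
Proof.
pose S : {set item} := [set inl j | j : option 'I_h].
have SI : S :&: hidden = hidden.
  apply/setIidPr/subsetP => -[[j|]|[b l]]; rewrite inE // => _.
  by rewrite imset_f.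
apply: (@le_trans _ _ (hard S)).
  have bigS : big_item \in S by rewrite imset_f.
  rewrite /hard /deficit; have -> : S :&: [set big_item] = [set big_item].
    by apply/setIidPr; rewrite sub1set.
  rewrite SI card_hidden cards1 !subnn mulr0n !mulr0 addr0 subr0 lerD2l lerDr.
  by rewrite mulr_ge0 ?ler0n // mulr_ge0 ?ler0n.
rewrite /opt /fmax; apply: (le_bigmax_cond _ (P := fun S' => _)).
by rewrite subsetT card_imset ?card_option ?card_ord //= => ? ? [].
Qed.


Lemma card_blocks (D T : {set item}) (B : finType) (g : B -> 'I_n + 'I_k') :
  injective g -> (forall b l, (inr (g b, l) : item) \in D) ->
  (forall b, exists l, (inr (b, l) : item) \in T) -> (#|B| <= #|T :&: D|)%N.
Proof.
move=> ginj gD hit.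
have hit_bool b : exists l, (inr (g b, l) : item) \in T by exact: hit.
pose c b : item := inr (g b, xchoose (hit_bool b)).
have cinj : injective c by move=> b1 b2 [/ginj].
rewrite -(card_imset _ cinj); apply: subset_leq_card.
by apply/subsetP => _ /imsetP[b _ ->]; rewrite inE gD (xchooseP (hit_bool b)).
Qed.

(** By induction on the run: with no big or hidden item taken and cover deficit [d], a hidden item
    gains [2 (h - 1) + 2 d]. A cover gains [2 h + 2 d] while [d > 0], and a filler gains [2 h] once
    [d = 0]; both are strictly better. *)
Lemma greedy_run_no_hidden T t S :
  big_item \notin T -> (forall b, exists l, (inr (b, l) : item) \in T) ->
  greedy_run hard T t S -> (t <= k')%N -> S :&: hidden = set0.
Proof.
move=> bigT hit run.
have coversT : (n <= #|T :&: covers|)%N.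
  rewrite -{1}[n]card_ord; apply: (card_blocks (g := inl)) => // [? ? []//|b l].
  by rewrite inE.
have fillersT : (k' <= #|T :&: fillers|)%N.
  rewrite -{1}[k']card_ord; apply: (card_blocks (g := inr)) => // [? ? []//|b l].
  by rewrite inE.
elim: run => [|p {}S x run IH xTS xmax|p {}S _ IH _] pk.
- by rewrite set0I.
- have {IH}S0 : S :&: hidden = set0 by apply: IH; exact: ltnW.
  have [ST Sp] := greedy_run_sub run.
  have bigS : S :&: [set big_item] = set0.
    apply: disjoint_setI0; rewrite disjoint_sym disjoints1.
    by apply: contra bigT; exact: (subsetP ST).
  rewrite setIUl S0 setU0; apply: disjoint_setI0; rewrite disjoints1.
  apply/negP => xH.
  have xS : x \notin S by move: xTS; rewrite inE => /andP[].
  have h0 : (0 < h)%N.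
    by rewrite -card_hidden; apply/card_gt0P; exists x.
  have margx : marginal hard S x = 2 * (h%:R - 1) + 2 * deficit covers n S.
    rewrite /marginal /hard /deficit !cards_setU1I // xH bigS S0 !cards0.
    case: x {xmax xTS xS} xH => [[j|]|[b l]]; rewrite !inE //= => _.
    by rewrite !addn0 !add0n !subn0 (natrB _ h0); ring.
  have [lt|ge] := ltnP #|S :&: covers| n.
    have [y yD yTS] := exists_fresh (leq_trans lt coversT).
    have yS : y \notin S by move: yTS; rewrite inE => /andP[].
    have := xmax _ yTS; rewrite leNgt => /negP[].
    rewrite margx /marginal /hard /deficit !cards_setU1I // bigS S0 !cards0.
    case: y {yTS yS} yD => [[j|]|[[b|b] l]]; rewrite !inE //= => _.
    rewrite !addn0 !add0n !subn0 !natrB //; last exact: ltnW.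
    by rewrite natrD; lra.
  (* Fewer than [k'] items have been taken, while [T] meets all [k'] filler blocks. *)
  have [y yD yTS] : exists2 y, y \in fillers & y \in T :\: S.
    apply: exists_fresh; apply: leq_trans fillersT; apply: leq_trans pk.
    by rewrite ltnS; apply: leq_trans Sp; rewrite subset_leq_card ?subsetIl.
  have yS : y \notin S by move: yTS; rewrite inE => /andP[].
  have := xmax _ yTS; rewrite leNgt => /negP[].
  rewrite margx /marginal /hard /deficit !cards_setU1I // bigS S0 !cards0.
  case: y {yTS yS} yD => [[j|]|[[b|b] l]]; rewrite !inE //= => _.
  rewrite !addn0 !add0n !subn0 (eqP ge) natrD.
  by lra.
- by apply: IH; exact: ltnW.
Qed.

End HardInstance.

(** * The expected number of hidden items selected *)

Section HiddenSelected.
Context {R : realType} (h n k' L m : nat).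
Implicit Types (x : item h n k' L) (s : {ffun item h n k' L -> {set 'I_m}}).

Definition block (b : 'I_n + 'I_k') : {set item h n k' L} :=
  [set inr (b, l) | l : 'I_L].

Lemma card_block b : #|block b| = L.
Proof. by rewrite card_imset ?card_ord // => ? ? []. Qed.

(** Union bound: a machine returning [x] either holds both [x] and the big item or misses an entire
    block. Both events are written as products of indicators so that independence applies. *)
Lemma hidden_selected_le Greedy s x :
  is_greedy (@hard R h n k' L) k' Greedy -> x \in hidden h n k' L ->
  (x \in \bigcup_(i < m) Greedy (received s i))%:R <=
    \sum_(i < m) (\prod_(y in [set x; big_item h n k' L]) (i \in s y)%:R
      + \sum_b \prod_(y in block b) (i \notin s y)%:R) :> R.
Proof.
move=> greedyG xH.
have prod_ge0 (D : {set item h n k' L}) (P : item h n k' L -> bool) :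
  0 <= \prod_(y in D) (P y)%:R :> R by apply: prodr_ge0 => y _; exact: ler0n.
have term_ge0 (i : 'I_m) :
    0 <= \prod_(y in [set x; big_item h n k' L]) (i \in s y)%:R
      + \sum_b \prod_(y in block b) (i \notin s y)%:R :> R.
  by rewrite addr_ge0 ?sumr_ge0.
have [/bigcupP[i _ xG]|_] := boolP (x \in _); last by rewrite sumr_ge0.
rewrite (bigD1 i) //= -[leLHS]addr0 lerD ?sumr_ge0 //.
have run := greedyG (received s i).
have [/subsetP GT _] := greedy_run_sub run.
have xT : i \in s x by have := GT _ xG; rewrite inE.
have [bigT|bigT] := boolP (big_item h n k' L \in received s i).
  rewrite big1 ?lerDl ?sumr_ge0 // => y; rewrite !inE => /orP[]/eqP ->.
    by rewrite xT.
  by move: bigT; rewrite inE => ->.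
have /existsP[b /forallP missed] :
    [exists b, forall l, (inr (b, l) : item h n k' L) \notin received s i].
  apply: contraT => /existsPn hit.
  have : x \in Greedy (received s i) :&: hidden h n k' L.
    by rewrite inE xG.
  rewrite (greedy_run_no_hidden bigT _ run) ?inE // => b.
  by have /forallPn[l] := hit b; rewrite negbK; exists l.
rewrite (bigD1 b) //= [\prod_(y in block b) _]big1 => [|y /imsetP[l _ ->]].
  by rewrite addrCA lerDl addr_ge0 ?sumr_ge0.
by have := missed l; rewrite inE => ->.
Qed.

Lemma expectation_hidden_selected_le C Greedy :
  (C <= m)%N -> is_greedy (@hard R h n k' L) k' Greedy ->
  expectation C (fun s =>
    #|(\bigcup_(i < m) Greedy (received s i)) :&: hidden h n k' L|%:R)
  <= h%:R * (m%:R * ((C%:R / m%:R) ^+ 2 + (n + k')%:R * (1 - C%:R / m%:R) ^+ L))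
  :> R.
Proof.
move=> leCm greedyG.
pose cost x s : R := \sum_(i < m)
  (\prod_(y in [set x; big_item h n k' L]) (i \in s y)%:R
   + \sum_b \prod_(y in block b) (i \notin s y)%:R).
apply: (@le_trans _ _ (expectation C (fun s =>
  \sum_(x in hidden h n k' L) cost x s))).
  apply: le_expectation => s _; rewrite -sum1_card natr_sum.
  rewrite (eq_bigl (fun x => (x \in hidden h n k' L) &&
    (x \in \bigcup_(i < m) Greedy (received s i)))) => [|x].
    rewrite big_mkcondr; apply: ler_sum => x xH.
    by have := hidden_selected_le s greedyG xH; case: (x \in \bigcup_(i < m) _).
  by rewrite inE andbC.
rewrite /cost expectation_sum.
rewrite (eq_bigr (fun=> m%:R * ((C%:R / m%:R) ^+ 2
  + (n + k')%:R * (1 - C%:R / m%:R) ^+ L))) => [|x xH].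
  by rewrite sumr_const card_hidden [leRHS]mulr_natl.
rewrite /cost expectation_sum.
rewrite (eq_bigr (fun=> (C%:R / m%:R) ^+ 2
  + (n + k')%:R * (1 - C%:R / m%:R) ^+ L)) => [|i _].
  by rewrite sumr_const card_ord [RHS]mulr_natl.
rewrite expectationD (expectation_prod _ (fun A => (i \in A)%:R)) //.
rewrite draw_mean_in //.
congr (_ ^+ _ + _).
  by rewrite cards2; case: eqP xH => // ->; rewrite inE.
rewrite expectation_sum (eq_bigr (fun=> (1 - C%:R / m%:R) ^+ L)) => [|b _].
  by rewrite sumr_const card_sum !card_ord [RHS]mulr_natl.
rewrite (expectation_prod _ (fun A => (i \notin A)%:R)) // draw_mean_notin //.
by rewrite card_block.
Qed.

End HiddenSelected.

(** * Final estimates and choice of parameters *)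

Lemma exists_expr_le (R : realType) (x d : R) :
  0 <= x < 1 -> 0 < d -> exists L, x ^+ L <= d.
Proof.
move=> /andP[x0 x1] d0.
(* A Bernoulli inequality in a form that also covers [x = 0], which occurs for a single machine. *)
have bernoulli L : x ^+ L * (1 + L%:R * (1 - x)) <= 1.
  elim: L => [|L IH]; first by rewrite expr0 mul0r addr0 mulr1.
  apply: le_trans IH; rewrite exprS -mulrA mulrCA ler_wpM2l ?exprn_ge0 //.
  rewrite -natr1; have : 0 <= (L%:R + 1) * (1 - x) ^+ 2 :> R.
    by rewrite mulr_ge0 ?sqr_ge0 // addr_ge0.
  by lra.
have y0 : 0 < d * (1 - x) by rewrite mulr_gt0 ?subr_gt0.
exists (Num.bound (d * (1 - x))^-1).
set L := Num.bound _.
have : (d * (1 - x))^-1 < L%:R by apply: archi_boundP; rewrite invr_ge0 ltW.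
rewrite -(ltr_pM2l y0) divff ?gt_eqF // => dL.
have := bernoulli L; have : 0 <= x ^+ L by rewrite exprn_ge0.
move: (x ^+ L) => z z0 zL.
have Lx : 0 <= L%:R * (1 - x) by rewrite mulr_ge0 // subr_ge0 ltW.
rewrite -(ler_pM2r (_ : 0 < 1 + L%:R * (1 - x))) ?ltr_pwDl //.
by apply: le_trans zL _; nra.
Qed.

Lemma hardness_ratio (R : realType) (H M eps s : R) :
  0 <= s -> s ^+ 2 = 2 -> 1 <= H -> 5 <= eps * H ->
  H <= M -> M <= s * H -> s * H < M + 1 ->
  M * (M + 1) + 2 * H * (H + 1) + 2 * (H + M) * (H * (2 * eps))
  <= (2 - s + 10 * eps) * (2 * M * H + M * (M + 1) + 2 * (H - 1) * H).
Proof.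
move=> s0 s2 H1 epsH HM Ms sM.
have s_ge : 14 / 10 <= s by nra.
have s_le : s <= 15 / 10 by nra.
have eps0 : 0 <= eps by nra.
have opt_ge : 4 * H ^+ 2 <= 2 * M * H + M * (M + 1) + 2 * (H - 1) * H by nra.
(* Since [s ^+ 2 = 2], the quadratic part is a perfect square vanishing at [M = s H]. Rounding [M]
   to an integer thus leaves only terms linear in [H], absorbed by [5 <= eps * H]. *)
have gap : M * (M + 1) + 2 * H * (H + 1)
    - (2 - s) * (2 * M * H + M * (M + 1) + 2 * (H - 1) * H)
  = (s - 1) * (M - s * H) ^+ 2 + (M * (s - 1) + 2 * H + 2 * (2 - s) * H).
  have -> : (s - 1) * (M - s * H) ^+ 2
    = (s - 1) * (M ^+ 2 - 2 * s * M * H + s ^+ 2 * H ^+ 2) by ring.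
  have -> : (s - 1) * (M ^+ 2 - 2 * s * M * H + s ^+ 2 * H ^+ 2)
    = (s - 1) * (M ^+ 2 + s ^+ 2 * H ^+ 2) - 2 * (s ^+ 2 - s) * M * H by ring.
  by rewrite s2; ring.
have sq : (M - s * H) ^+ 2 <= 1 by nra.
have MH : M <= 15 / 10 * H by nra.
have small : (s - 1) * (M - s * H) ^+ 2
    + (M * (s - 1) + 2 * H + 2 * (2 - s) * H) <= 5 * H.
  have : (s - 1) * (M - s * H) ^+ 2 <= 1 / 2 by nra.
  have : M * (s - 1) <= 15 / 10 * H * (1 / 2) by nra.
  have : 2 * (2 - s) * H <= 12 / 10 * H by nra.
  by lra.
have epsH2 : 5 * H <= eps * H ^+ 2 by nra.
have err : 2 * (H + M) * (H * (2 * eps)) <= 10 * (eps * H ^+ 2).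
  have : 0 <= eps * H by nra.
  by nra.
have : eps * (4 * H ^+ 2)
  <= eps * (2 * M * H + M * (M + 1) + 2 * (H - 1) * H) by rewrite ler_wpM2l.
have : 0 <= eps * H ^+ 2 by nra.
lra.
Qed.

Theorem theorem6 (R : realType) :
  exists2 K : R, 0 < K &
  forall eps : R, 0 < eps ->
  exists k0 : nat, forall k k' : nat, (k0 <= k)%N -> (k <= k')%N ->
  forall m : nat, (0 < m)%N ->
  exists (N : finType) (f : {set N} -> R),
    [/\ nonnegative f, monotone f, submodular f & 0 < opt f k] /\
    forall (C : nat) (Greedy : {set N} -> {set N}),
      (0 < C <= m)%N -> C%:R <= Num.sqrt (eps * m%:R) ->
      is_greedy f k' Greedy ->
      expectation C (fun s : {ffun N -> {set 'I_m}} =>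
        fmax f k (\bigcup_(i < m) Greedy (received s i)))
      <= (2 - Num.sqrt 2 + K * eps) * opt f k.
Proof.
exists 10; first by [].
(* For [h = k - 1] this threshold ensures [1 <= h] and [5 <= eps * h]. *)
move=> eps eps0; exists (Num.bound (5 / eps)).+2.
case=> // h k' hk kk' m m0.
set s : R := Num.sqrt 2.
have s0 : 0 <= s by rewrite sqrtr_ge0.
have s2 : s ^+ 2 = 2 by rewrite sqr_sqrtr.
rewrite ltnS in hk.
have h0 : (0 < h)%N by exact: leq_trans hk.
have H1 : 1 <= h%:R :> R by rewrite ler1n.
have epsH : 5 <= eps * h%:R.
  rewrite mulrC -ler_pdivrMr //; apply/ltW/(lt_le_trans (archi_boundP _)).
    by rewrite divr_ge0 // ltW.
  by rewrite ler_nat ltnW.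
have sh0 : 0 <= s * h%:R by rewrite mulr_ge0.
pose n := Num.truncn (s * h%:R).
have /andP[ns sn] := truncn_itv sh0; rewrite -/n in ns sn.
have hn : (h <= n)%N.
  by rewrite truncn_ge_nat // ler_peMl //; nra.
have m0R : 0 < m%:R :> R by rewrite ltr0n.
have nk0 : 0 < (n + k')%:R :> R.
  by rewrite ltr0n addn_gt0 (leq_trans h0 hn).
(* The instance is fixed before [C], so [L] is chosen for [C = 1], where missing a block is
   likeliest. The denominator pays for the union over [m] machines and [n + k'] blocks. *)
have [L Lsmall] : exists L,
    (1 - m%:R^-1) ^+ L <= eps / (m%:R * (n + k')%:R) :> R.
  apply: exists_expr_le; last by rewrite divr_gt0 // mulr_gt0.
  by rewrite subr_ge0 invf_le1 // ler1n m0 ltrBlDr ltrDl invr_gt0.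
have hnR : h%:R <= n%:R :> R by rewrite ler_nat.
have sn1 : s * h%:R < n%:R + 1 by rewrite natr1.
have opt_ge : 2 * n%:R * h%:R + n%:R * (n%:R + 1) + 2 * (h%:R - 1) * h%:R
    <= opt (@hard R h n k' L) h.+1 by exact: hard_opt_lower.
have opt0 : 0 < opt (@hard R h n k' L) h.+1.
  apply: lt_le_trans opt_ge; apply: ltr_wpDr.
    by rewrite !mulr_ge0 // subr_ge0.
  apply: ltr_wpDr; first by rewrite mulr_ge0 // addr_ge0.
  by rewrite !mulr_gt0 ?ltr0n // (leq_trans h0 hn).
exists (item h n k' L), (@hard R h n k' L); split.
  split=> //; [exact: hard_nonnegative|exact: hard_monotone|].
  exact: hard_submodular.
move=> C Greedy /andP[C0 leCm] Ceps greedyG.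
have C2 : C%:R ^+ 2 <= eps * m%:R.
  have em : 0 <= eps * m%:R by rewrite mulr_ge0 // ltW.
  by rewrite -(sqr_sqrtr em) lerXn2r // nnegrE // sqrtr_ge0.
have missed : m%:R * ((n + k')%:R * (1 - C%:R / m%:R) ^+ L) <= eps.
  rewrite mulrA mulrC -ler_pdivlMr ?mulr_gt0 //; apply: le_trans Lsmall.
  apply: lerXn2r; rewrite ?nnegrE.
  - by rewrite subr_ge0 ler_pdivrMr // mul1r ler_nat.
  - by rewrite subr_ge0 invf_le1 // ler1n.
  - by rewrite lerB // -[leLHS]mul1r ler_pM2r ?invr_gt0 // ler1n.
have met : m%:R * (C%:R / m%:R) ^+ 2 <= eps.
  have -> : m%:R * (C%:R / m%:R) ^+ 2 = C%:R ^+ 2 / m%:R :> R.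
    by field; rewrite gt_eqF.
  by rewrite ler_pdivrMr.
(* The upper bound is affine in the number of hidden items selected, so only the expectation of that
   number remains to be bounded. *)
apply: (@le_trans _ _ (expectation (N := item h n k' L) C
  (fun t : {ffun item h n k' L -> {set 'I_m}} =>
  (n%:R * (n%:R + 1) + 2 * h%:R * h.+1%:R)
  + 2 * (h%:R + n%:R) *
    #|(\bigcup_(i < m) Greedy (received t i)) :&: hidden h n k' L|%:R))).
  apply: le_expectation => t _; apply: bigmax_le => [|S /andP[SU Sk]].
    by rewrite !addr_ge0 ?mulr_ge0 ?addr_ge0.
  apply: (le_trans (hard_upper Sk)).
  rewrite lerD2l ler_wpM2l ?mulr_ge0 ?addr_ge0 // ler_nat.
  by rewrite subset_leq_card // setSI.
rewrite expectationD expectationZ expectation_cst //.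
have := expectation_hidden_selected_le leCm greedyG.
set E := expectation _ _ => leE.
have leE2 : E <= h%:R * (2 * eps).
  by apply: le_trans leE _; rewrite ler_wpM2l // mulrDr; lra.
(* A nonnegative coefficient lets the optimum be replaced by its explicit lower bound. *)
have coef0 : 0 <= 2 - s + 10 * eps.
  have : s <= 2 by nra.
  by lra.
apply: le_trans (ler_wpM2l coef0 opt_ge).
apply: le_trans (hardness_ratio s0 s2 H1 epsH hnR ns sn1).
by rewrite -[h.+1%:R]natr1 lerD2l ler_wpM2l // mulr_ge0 // addr_ge0.
Qed.
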